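(* Let $n$ be a positive integer, let $\mathcal{M}_n$ be the set of $n\times n$ complex matrices, and let $Q\in\mathcal{M}_n$ be a projection of rank $1$. If $M\in\mathcal{M}_n$ and there is a nonzero projection $P\in\mathcal{M}_n$ such that $PMP=M$ and $M^*M\geq P$, then $\nu(M)\geq\nu(Q)$.
   Context: A projection is a hermitian idempotent matrix. For hermitian matrices $A,B$, $A\leq B$ means that $B-A$ is positive semidefinite. $\|\cdot\|$ is the operator norm on $\mathcal{M}_n$ (induced by the Euclidean norm on $\mathbb{C}^n$). For $A\in\mathcal{M}_n$, $\nu(A)=\inf\{\|A-N\| : N\in\mathcal{M}_n \text{ nilpotent}\}$ is the distance from $A$ to the nilpotent matrices. Since $\nu$ is invariant under unitary conjugation, $\nu(Q)$ does not depend on the choice of the rank-one projection $Q$; it is known (MacDonald, 1995) that $\nu(Q)=\frac12\sec\frac{\pi}{n+2}$. *)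

(* Defs.v *)
From mathcomp Require Import all_boot all_order all_algebra.
From mathcomp Require Import all_classical reals complex.

Set Implicit Arguments.
Unset Strict Implicit.
Unset Printing Implicit Defensive.
Import Order.TTheory GRing.Theory Num.Theory.
Local Open Scope ring_scope.
Local Open Scope classical_set_scope.
Local Open Scope sesquilinear_scope.
Local Open Scope complex_scope.

Section Matrices.
Variables (R : realType) (n : nat).
Implicit Types A B N P : 'M[R[i]]_n.

Definition is_projection P : Prop := P \is hermsymmx /\ P *m P = P.

Definition psdmx A : Prop :=
  A \is hermsymmx /\ forall x : 'cV[R[i]]_n, 0 <= (x ^t* *m A *m x) 0 0.

Definition loewner_le A B : Prop := psdmx (B - A).

Definition nilpotentmx N : Prop := exists k : nat, N ^+ k = 0.

(* [normc] is the modulus with values in [R], whereas [`|z|] on [R[i]] is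
   [R[i]]-valued. *)
Definition enorm (x : 'cV[R[i]]_n) : R :=
  Num.sqrt (\sum_(i < n) Normc.normc (x i 0) ^+ 2).

Definition opnorm A : R :=
  sup [set enorm (A *m x) | x in [set x : 'cV[R[i]]_n | enorm x <= 1]].

Definition nu A : R :=
  inf [set opnorm (A - N) | N in [set N | nilpotentmx N]].

End Matrices.

(* Main.v *)
(** Let [h = pi / (n+2)], [t = 1 / (4 cos^2 h)], and let [b_0 = 0],
    [b_(k+1) (1 - b_k) = t]; then [b] increases and reaches [1] exactly at
    [k = n]. Both [nu Q <= sqrt t] and [sqrt t <= nu M] hold.

    Lower bound: if [N] is nilpotent and [|(M - N) x| <= d |x|] with [d^2 < t],
    then [|P v|^2 <= b_k |v|^2] for all [v] in [ker N^k], by induction on [k].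
    For [v] in [ker N^(k+1)], the vector [w = M v] lies in the range of [P],
    [u = N v] lies in [ker N^k], and the induction hypothesis for [u] gives
    [d^2 |v|^2 >= |w - u|^2 >= (1 - b_k) |w|^2 >= (1 - b_k) |P v|^2]. At
    [k = n] the kernel is everything and the estimate is strict, which
    contradicts [P <> 0].

    Upper bound: let [v] be the unit vector with [v_k^2 = b_(k+1) - b_k] and
    [E_k] the projection onto the first [k] coordinates. The map sending
    [E_k v] to [b_k (v - E_(k-1) v)], for [1 <= k <= n], is [sqrt t] times an
    isometry and agrees with [v v^*] on and below the diagonal, so it differs
    from [v v^*] by a nilpotent matrix. *)

Require Import Defs.
From mathcomp Require Import all_boot all_order all_algebra.
From mathcomp Require Import all_classical reals complex trigo.
From mathcomp Require Import ring lra.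
Import Order.TTheory GRing.Theory Num.Theory.
Local Open Scope ring_scope.
Local Open Scope classical_set_scope.
Local Open Scope sesquilinear_scope.
Local Open Scope complex_scope.
Set Implicit Arguments.
Unset Strict Implicit.
Unset Printing Implicit Defensive.

(* The witness is [t = 1 / (4 cos^2 (pi / (n+2)))], the square of MacDonald's
   value of [nu Q]. *)
Lemma critical_sequence (R : realType) (n : nat) : (0 < n)%N ->
  exists t : R, exists b : nat -> R,
    [/\ 0 < t, b 0%N = 0, b n = 1, forall k, (k < n)%N -> b k < 1
      & forall k, (k < n)%N -> b k.+1 * (1 - b k) = t].
Proof.
move=> n_gt0.
have n2_gt0 : 0 < n.+2%:R :> R by rewrite ltr0n.
pose h : R := pi / n.+2%:R.
have h_gt0 : 0 < h by rewrite divr_gt0 ?pi_gt0.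
have n2h : n.+2%:R * h = pi by rewrite /h mulrC divfK ?gt_eqF.
have s_gt0 k : (k <= n)%N -> 0 < sin (k.+1%:R * h).
  move=> kn; apply: sin_gt0_pi; rewrite mulr_gt0 ?ltr0n //= -n2h.
  by rewrite ltr_pM2r // ltr_nat ltnS.
(* Here [0 < n] enters: it gives h < pi / 2. *)
have c_gt0 : 0 < cos h.
  apply: cos_gt0_pihalf; apply/andP; split.
    by rewrite (lt_trans _ h_gt0) // oppr_lt0 divr_gt0 ?pi_gt0.
  by rewrite /h ltr_pM2l ?pi_gt0 // ltf_pV2 ?posrE ?ltr0n // ltr_nat !ltnS.
have sin_rec k : sin (k.+2%:R * h) =
    2 * cos h * sin (k.+1%:R * h) - sin (k%:R * h).
  have -> : k.+2%:R * h = k.+1%:R * h + h by rewrite -(natr1 k.+1); ring.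
  have -> : k%:R * h = k.+1%:R * h - h by rewrite -(natr1 k); ring.
  rewrite sinD sinB; ring.
(* A ratio of consecutive terms turns the recursion for b into the linear recurrence [sin_rec]. The
   solution sin (k h) vanishes at k = 0 and at k = n + 2, whence b_0 = 0 and 1 - b_n = 0. *)
pose b k : R := sin (k%:R * h) / (2 * cos h * sin (k.+1%:R * h)).
have b1 k : (k <= n)%N ->
    1 - b k = sin (k.+2%:R * h) / (2 * cos h * sin (k.+1%:R * h)).
  move=> kn; rewrite sin_rec /b; have := s_gt0 _ kn => s0.
  by field; rewrite !gt_eqF.
exists (4 * cos h ^+ 2)^-1, b; split.
- by rewrite invr_gt0 mulr_gt0 ?exprn_gt0.
- by rewrite /b mul0r sin0 mul0r.
- by apply/eqP; rewrite eq_sym -subr_eq0 b1 // n2h sinpi mul0r eqxx.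
- by move=> k kn; rewrite -subr_gt0 b1 1?ltnW // divr_gt0 ?mulr_gt0 // s_gt0 // ltnW.
- move=> k kn; rewrite b1 1?ltnW // /b.
  have sk := s_gt0 _ (ltnW kn); have sk1 := s_gt0 _ kn.
  by field; rewrite !gt_eqF.
Qed.

(** The minimal polynomial divides ['X^k], so it is associated to some ['X^m]; and m <= n because it
    divides the characteristic polynomial. *)
Lemma nilpotentmx_exprn (F : fieldType) (n k : nat) (N : 'M[F]_n) :
  N ^+ k = 0 -> N ^+ n = 0.
Proof.
case: n N => [|n] N Nk; first by apply/matrixP => -[].
have /mxminpoly_min : horner_mx N 'X^k = 0 by rewrite rmorphXn /= horner_mx_X.
rewrite -['X]subr0 -polyC0 => /dvdp_exp_XsubCP [m _ Em].
have le_mn : (m <= n.+1)%N.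
  have := dvdp_leq (monic_neq0 (char_poly_monic N)) (mxminpoly_dvd_char N).
  by rewrite size_char_poly (eqp_size Em) subr0 size_polyXn.
have Nm : N ^+ m = 0.
  have : mxminpoly N %| 'X^m by rewrite (eqp_dvdl _ Em) subr0.
  by move/mxminpoly_minP; rewrite rmorphXn /= horner_mx_X.
by have := exprD N (n.+1 - m) m; rewrite (subnK le_mn) Nm mulr0.
Qed.

(** Taking the real part leaves norms unchanged, still lets adjoints cross, and gives a symmetric
    form with values in the ordered field [R]. *)
Definition rdot (R : realType) (n : nat) (x y : 'cV[R[i]]_n) : R :=
  complex.Re ((x ^t* *m y) 0 0).

(** * Euclidean norm, operator norm and [nu] *)

Section RealInnerProduct.
Variables (R : realType) (n : nat).
Implicit Types (x y z : 'cV[R[i]]_n) (A : 'M[R[i]]_n).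

Lemma rdotE x y : rdot x y = \sum_i complex.Re ((x i 0)^* * y i 0).
Proof. by rewrite /rdot mxE raddf_sum; apply: eq_bigr => i _; rewrite !mxE. Qed.

Lemma rdotC x y : rdot x y = rdot y x.
Proof.
rewrite !rdotE; apply: eq_bigr => i _.
by case: (x i 0) (y i 0) => a b [c d] /=; ring.
Qed.

Lemma rdotBr x y z : rdot x (y - z) = rdot x y - rdot x z.
Proof. by rewrite /rdot mulmxBr !mxE raddfB. Qed.

Lemma rdotZr (a : R) x y : rdot x (a%:C *: y) = a * rdot x y.
Proof.
rewrite /rdot -scalemxAr mxE; case: ((x ^t* *m y) 0 0) => b c /=.
by rewrite mul0r subr0.
Qed.

Lemma rdotBl x y z : rdot (x - y) z = rdot x z - rdot y z.
Proof. by rewrite rdotC rdotBr ![rdot z _]rdotC. Qed.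

Lemma rdotZl (a : R) x y : rdot (a%:C *: x) y = a * rdot x y.
Proof. by rewrite rdotC rdotZr rdotC. Qed.

Lemma rdot_mull A x y : rdot (A *m x) y = rdot x (A ^t* *m y).
Proof. by rewrite /rdot trmx_mul map_mxM mulmxA. Qed.

Lemma rdotxx x : rdot x x = \sum_i Normc.normc (x i 0) ^+ 2.
Proof.
rewrite rdotE; apply: eq_bigr => i _; case: (x i 0) => a b /=.
by rewrite sqr_sqrtr ?addr_ge0 ?sqr_ge0 //; ring.
Qed.

Lemma rdot_ge0 x : 0 <= rdot x x.
Proof. by rewrite rdotxx sumr_ge0 // => i _; rewrite sqr_ge0. Qed.

Lemma rdot_eq0 x : rdot x x = 0 -> x = 0.
Proof.
rewrite rdotxx => /eqP; rewrite psumr_eq0 => [/allP x0|i _]; last exact: sqr_ge0.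
apply/matrixP => i j; rewrite ord1 mxE; apply: Normc.eq0_normc; apply/eqP.
by have := x0 i (mem_index_enum i); rewrite sqrf_eq0.
Qed.

Lemma enormE x : enorm x = Num.sqrt (rdot x x).
Proof. by rewrite /enorm rdotxx. Qed.

Lemma sqr_enorm x : enorm x ^+ 2 = rdot x x.
Proof. by rewrite enormE sqr_sqrtr ?rdot_ge0. Qed.

Lemma enorm_ge0 x : 0 <= enorm x.
Proof. by rewrite enormE sqrtr_ge0. Qed.

Lemma enorm0 : enorm (0 : 'cV[R[i]]_n) = 0.
Proof.
rewrite enormE rdotxx big1 ?sqrtr0 // => i _.
by rewrite mxE Normc.normc0 expr0n.
Qed.

Lemma enormZ (a : R) x : 0 <= a -> enorm (a%:C *: x) = a * enorm x.
Proof.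
move=> a0; rewrite !enormE rdotZl rdotZr mulrA -expr2 sqrtrM ?sqr_ge0 //.
by rewrite sqrtr_sqr ger0_norm.
Qed.

Lemma normc_le_enorm x i : Normc.normc (x i 0) <= enorm x.
Proof.
rewrite -(ler_pXn2r (n := 2)) ?nnegrE ?enorm_ge0 //; last first.
  by case: (x i 0) => a b; rewrite sqrtr_ge0.
rewrite sqr_enorm rdotxx (bigD1 i) //= lerDl sumr_ge0 // => j _.
exact: sqr_ge0.
Qed.

(** Only finiteness matters: it ensures that the [sup] in [opnorm] is a true supremum and not a
    default value. Row sums of moduli give a crude constant. *)
Lemma enorm_mul_bounded A : exists C : R, forall x, enorm (A *m x) <= C * enorm x.
Proof.
pose r i := \sum_j Normc.normc (A i j).
have nc0 (z : R[i]) : 0 <= Normc.normc z by case: z => a b; rewrite sqrtr_ge0.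
have entry_le x i : Normc.normc ((A *m x) i 0) <= r i * enorm x.
  rewrite mxE mulr_suml.
  apply: (@le_trans _ _ (\sum_j Normc.normc (A i j * x j 0))).
    elim/big_ind2: _ => [|a b c d le_ab le_cd|//]; first by rewrite Normc.normc0.
    exact: le_trans (le_normcD _ _) (lerD le_ab le_cd).
  apply: ler_sum => j _; rewrite Normc.normcM ler_wpM2l ?nc0 //.
  exact: normc_le_enorm.
exists (Num.sqrt (\sum_i r i ^+ 2)) => x.
rewrite -(ler_pXn2r (n := 2)) ?nnegrE ?mulr_ge0 ?sqrtr_ge0 ?enorm_ge0 //.
rewrite sqr_enorm exprMn sqr_sqrtr; last by apply: sumr_ge0 => i _; exact: sqr_ge0.
rewrite rdotxx mulr_suml; apply: ler_sum => i _; rewrite -exprMn.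
by apply: lerXn2r; rewrite ?nnegrE ?mulr_ge0 ?enorm_ge0 ?sumr_ge0 ?nc0.
Qed.

Lemma opnorm_has_ubound A :
  has_ubound [set enorm (A *m x) | x in [set x : 'cV[R[i]]_n | enorm x <= 1]].
Proof.
have [C hC] := enorm_mul_bounded A; exists `|C| => _ [y /= y1 <-].
apply: le_trans (hC y) _; apply: le_trans (ler_norm _) _.
by rewrite normrM [`|enorm y|]ger0_norm ?enorm_ge0 // ler_piMr.
Qed.

Lemma enorm_mul_le_opnorm A x : enorm (A *m x) <= opnorm A * enorm x.
Proof.
have [->|x0] := eqVneq x 0; first by rewrite mulmx0 enorm0 mulr0.
have ex_gt0 : 0 < enorm x.
  rewrite lt_def enorm_ge0 andbT; apply: contraNneq x0 => ex0.
  by apply/eqP/rdot_eq0; rewrite -sqr_enorm ex0 expr0n.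
rewrite -ler_pdivrMr // mulrC -enormZ ?invr_ge0 ?enorm_ge0 // scalemxAr.
apply: ub_le_sup (opnorm_has_ubound A) _ _.
by eexists; [|reflexivity]; rewrite /= enormZ ?invr_ge0 ?enorm_ge0 ?mulVf ?gt_eqF.
Qed.

Lemma opnorm_le A (c : R) :
  (forall x, enorm x <= 1 -> enorm (A *m x) <= c) -> opnorm A <= c.
Proof.
move=> hA; apply: ge_sup => [|_ [x /= x1 <-]]; last exact: hA.
by exists (enorm (A *m 0)), 0 => //=; rewrite enorm0.
Qed.

Lemma opnorm_ge0 A : 0 <= opnorm A.
Proof.
by apply: ub_le_sup (opnorm_has_ubound A) _ _; exists 0; rewrite /= ?mulmx0 enorm0.
Qed.

Lemma nu_le A N (c : R) :
  nilpotentmx N -> (forall x, enorm x <= 1 -> enorm ((A - N) *m x) <= c) ->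
  nu A <= c.
Proof.
move=> hN hc; apply: le_trans (opnorm_le hc).
apply: ge_inf; last by exists N.
by exists 0 => _ [N' _ <-]; exact: opnorm_ge0.
Qed.

Lemma le_nu A (c : R) :
  (forall N, nilpotentmx N -> c <= opnorm (A - N)) -> c <= nu A.
Proof.
move=> hc; apply: lb_le_inf => [|_ [N /= hN <-]]; last exact: hc.
by exists (opnorm (A - 0)), 0 => //=; exists 1%N; rewrite expr1.
Qed.

End RealInnerProduct.

(** * Lower bound for [nu M] *)

Section LowerBound.
Variables (R : realType) (n : nat).
Implicit Types (M N P : 'M[R[i]]_n).

Lemma is_projection_trC P : is_projection P -> P ^t* = P.
Proof.
by case=> /is_hermitianmxP herm _; rewrite {2}herm expr0 scale1r.
Qed.

Lemma rdot_projection P (x : 'cV[R[i]]_n) :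
  is_projection P -> rdot (P *m x) (P *m x) = rdot x (P *m x).
Proof.
by move=> hP; rewrite rdot_mull is_projection_trC // mulmxA hP.2.
Qed.

(** As <w, P u> = <w, u>, expanding the squares gives b (|w - u|^2 - (1 - b) |w|^2) = |b w - P u|^2
    + b |u|^2 - |P u|^2. *)
Lemma dist_lower_bound P (b : R) (w u : 'cV[R[i]]_n) :
  is_projection P -> P *m w = w -> 0 <= b ->
  rdot (P *m u) (P *m u) <= b * rdot u u ->
  (1 - b) * rdot w w <= rdot (w - u) (w - u).
Proof.
move=> hP Pw b0 hu.
have wu : rdot w (P *m u) = rdot w u.
  by rewrite -{2}Pw rdot_mull is_projection_trC.
have : 0 <= rdot (b%:C *: w - P *m u) (b%:C *: w - P *m u) by exact: rdot_ge0.
rewrite !(rdotBl, rdotBr, rdotZl, rdotZr) ![rdot (P *m u) w]rdotC wu.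
rewrite [rdot u w]rdotC => sq.
(* The identity must be divided by b. If b = 0, then P u = 0, so u is orthogonal to w and Pythagoras
   concludes. *)
have [b_gt0|b_le0] := ltP 0 b.
  set X := rdot w w in sq *; set Y := rdot w u in sq *.
  rewrite -subr_ge0 -(pmulr_rge0 _ b_gt0).
  apply: le_trans sq _; rewrite -subr_ge0.
  rewrite [X in 0 <= X](_ : _ = b * rdot u u - rdot (P *m u) (P *m u)) ?subr_ge0 //.
  ring.
have b_eq0 : b = 0 by apply/le_anti/andP.
move: hu wu; rewrite b_eq0 mul0r => hu.
have -> : P *m u = 0 by apply/rdot_eq0/le_anti/andP; split=> //; exact: rdot_ge0.
have -> : rdot w 0 = 0 by rewrite /rdot mulmx0 mxE.
by move=> <-; rewrite !subr0 sub0r opprK mul1r lerDl rdot_ge0.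
Qed.

Lemma nu_lower_bound M P (t : R) (b : nat -> R) :
  (0 < n)%N -> 0 < t -> b 0%N = 0 -> b n = 1 ->
  (forall k, (k < n)%N -> b k < 1) ->
  (forall k, (k < n)%N -> b k.+1 * (1 - b k) = t) ->
  is_projection P -> P <> 0 -> P *m M *m P = M ->
  loewner_le P (M ^t* *m M) -> Num.sqrt t <= nu M.
Proof.
move=> n_gt0 t_gt0 b0 bn b_lt1 b_rec hP P0 PMP [_ hpsd].
apply: le_nu => N [m Nm]; have Nn := nilpotentmx_exprn Nm.
rewrite leNgt; apply/negP => d_lt; set d := opnorm (M - N) in d_lt.
have d_ge0 : 0 <= d by exact: opnorm_ge0.
have d2_lt : d ^+ 2 < t.
  by rewrite -(sqr_sqrtr (ltW t_gt0)) ltr_pXn2r ?nnegrE ?sqrtr_ge0.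
have le_d x : rdot (M *m x - N *m x) (M *m x - N *m x) <= d ^+ 2 * rdot x x.
  rewrite -mulmxBl -!sqr_enorm -exprMn.
  rewrite ler_pXn2r ?nnegrE ?mulr_ge0 ?enorm_ge0 //.
  exact: enorm_mul_le_opnorm.
have PM (x : 'cV_n) : P *m (M *m x) = M *m x.
  by rewrite mulmxA -PMP !mulmxA hP.2.
have le_PM x : rdot (P *m x) (P *m x) <= rdot (M *m x) (M *m x).
  have := hpsd x; rewrite lecE => /andP[_] /=.
  rewrite -mulmxA -/(rdot _ _) mulmxBl rdotBr subr_ge0 -mulmxA -rdot_mull.
  by rewrite rdot_projection.
have b_ge0 k : (k <= n)%N -> 0 <= b k.
  case: k => [|k] kn; first by rewrite b0.
  rewrite -(pmulr_lge0 (b k.+1) (x := 1 - b k)) ?subr_gt0 ?b_lt1 //.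
  by rewrite b_rec // ltW.
pose small k := forall v, N ^+ k *m v = 0 ->
  rdot (P *m v) (P *m v) <= b k * rdot v v.
(* The bound keeps d^2 instead of t because [small n] would only be the trivial |P v| <= |v|. The
   contradiction comes from [step] at k = n - 1, where 1 - b k = t. *)
have step k v : (k < n)%N -> small k -> N ^+ k.+1 *m v = 0 ->
    (1 - b k) * rdot (P *m v) (P *m v) <= d ^+ 2 * rdot v v.
  move=> kn IH; rewrite exprSr -mulmxE -mulmxA => /IH hu.
  apply: le_trans _ (le_d v).
  apply: le_trans _ (dist_lower_bound hP (PM v) (b_ge0 _ (ltnW kn)) hu).
  by rewrite ler_wpM2l ?subr_ge0 ?le_PM // ltW // b_lt1.
have small_lt k : (k < n)%N -> small k.
  elim: k => [|k IH] kn v.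
    rewrite expr0 mul1mx => ->.
    by rewrite mulmx0 /rdot mulmx0 mxE /= mulr0.
  move=> /(step _ _ (ltnW kn) (IH (ltnW kn))) hv.
  have b1 : 0 < 1 - b k by rewrite subr_gt0 b_lt1 // ltnW.
  rewrite -(ler_pM2l b1); apply: le_trans hv _.
  rewrite mulrA [_ * b k.+1]mulrC b_rec 1?ltnW //.
  by rewrite ler_wpM2r ?rdot_ge0 // ltW.
have [k En] : exists k, n = k.+1 by exists n.-1; rewrite prednK.
have kn : (k < n)%N by rewrite En.
have tb : 1 - b k = t by rewrite -(b_rec _ kn) -En bn mul1r.
apply: P0; apply/matrixP => i j; rewrite [RHS]mxE.
(* A column of P is fixed by P, so [step] yields t |v|^2 <= d^2 |v|^2, which forces v = 0. *)
pose v := P *m delta_mx j 0 : 'cV[R[i]]_n.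
have Pv : P *m v = v by rewrite mulmxA hP.2.
have Pij : v i 0 = P i j by rewrite /v -colE mxE.
suff v0 : v = 0 by rewrite -Pij v0 mxE.
have /(step _ _ kn (small_lt _ kn)) : N ^+ k.+1 *m v = 0 by rewrite -En Nn mul0mx.
rewrite Pv tb => le_v.
apply/rdot_eq0/le_anti; rewrite rdot_ge0 andbT.
by rewrite -(pmulr_rle0 _ (x := t - d ^+ 2)) ?subr_gt0 // mulrBl subr_le0.
Qed.

End LowerBound.

(** * The extremal real matrix for the upper bound *)

Section CriticalMatrix.
Variables (R : realType) (n : nat) (t : R) (b : nat -> R).
Hypotheses (t_gt0 : 0 < t) (b0 : b 0%N = 0) (bn : b n = 1).
Hypothesis b_lt1 : forall k, (k < n)%N -> b k < 1.
Hypothesis b_rec : forall k, (k < n)%N -> b k.+1 * (1 - b k) = t.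

Let e k := Num.sqrt (b k.+1 - b k).
(* Column [k] holds the coordinates of the image of the [k]-th basis vector
   under the map of the header, obtained from the images of [E_k v] and
   [E_(k+1) v]. *)
Let a j k := if (k <= j)%N then e j * e k
  else if j.+1 == k then - (b k * e j / e k) else 0.

(** In b_(k+2) (1 - b_(k+1)) = t = b_(k+1) (1 - b_k), a smaller second factor forces a larger first
    one. *)
Let b_incr k : (k < n)%N -> b k < b k.+1.
Proof.
elim: k => [|k IH] kn; have := b_rec kn; have := b_lt1 kn.
  by rewrite b0 subr0 mulr1 => _ ->.
rewrite -subr_gt0 => b1 rec1; have := b_rec (ltnW kn); have := IH (ltnW kn).
have := b_lt1 (ltnW kn); rewrite -subr_gt0 => b2 lt_b rec.
have bk1 : 0 < b k.+1 by rewrite -(pmulr_lgt0 _ b2) rec.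
rewrite -(ltr_pM2r b1) rec1 -rec ltr_pM2l //; lra.
Qed.

Let sqr_e k : (k < n)%N -> e k ^+ 2 = b k.+1 - b k.
Proof. by move=> kn; rewrite sqr_sqrtr // subr_ge0 ltW // b_incr. Qed.

Let e_gt0 k : (k < n)%N -> 0 < e k.
Proof. by move=> kn; rewrite sqrtr_gt0 subr_gt0 b_incr. Qed.

Let sum_sqr_e k : (k <= n)%N -> \sum_(k <= j < n) e j ^+ 2 = 1 - b k.
Proof.
move=> kn; rewrite -bn -telescope_sumr //.
by apply: eq_big_nat => j /andP[_ /sqr_e].
Qed.

(** Rows from k on contribute e_i e_k (1 - b_k); above them column k has only its entry in row k -
    1. The two parts combine through e_k^2 (1 - b_k) = b_k e_(k-1)^2, both sides being t - b_k (1 -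
    b_k). *)
Let a_orthogonal i k : (i <= k)%N -> (k < n)%N ->
  \sum_(0 <= j < n) a j i * a j k = t *+ (i == k).
Proof.
move=> ik kn; rewrite (big_cat_nat (n := k)) ?(ltnW kn) //=.
have -> : \sum_(k <= j < n) a j i * a j k = e i * e k * (1 - b k).
  rewrite -sum_sqr_e 1?ltnW // mulr_sumr; apply: eq_big_nat => j /andP[kj _].
  by rewrite /a kj (leq_trans ik kj); ring.
(* Column 0 has no entry above the diagonal; its squared norm is e_0^2 = b_1 = t. *)
case: k ik kn => [|k] ik kn.
  move: ik; rewrite leqn0 => /eqP ->; rewrite big_geq // add0r.
  by rewrite -expr2 sqr_e // b0 eqxx mulr1n subr0 -(b_rec kn) b0 subr0.
rewrite big_nat_recr //= big_nat big1 ?add0r => [|j /andP[_ jk]]; last first.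
  by rewrite [a j k.+1]/a leqNgt ltnS (ltnW jk) /= eqSS (ltn_eqF jk) mulr0.
have ek := e_gt0 kn; have ek1 := e_gt0 (ltnW kn).
have [sk sk1] := (sqr_e (ltnW kn), sqr_e kn).
have [rk rk1] := (b_rec (ltnW kn), b_rec kn).
rewrite [a k k.+1]/a ltnn eqxx /a.
case: ltngtP ik => // [ik _|-> _].
  rewrite -ltnS ik.
  have -> : e k * e i * - (b k.+1 * e k / e k.+1) + e i * e k.+1 * (1 - b k.+1) =
      e i / e k.+1 * (e k.+1 ^+ 2 * (1 - b k.+1) - b k.+1 * e k ^+ 2).
    by field; rewrite gt_eqF.
  rewrite sk1 sk (_ : _ - _ = 0) ?mulr0 //.
  by rewrite -[RHS](subrr t) -{1}rk1 -rk; ring.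
(* On the diagonal the parts add up to (b_(k+1) + e_(k+1)^2) (1 - b_(k+1)) = b_(k+2) (1 - b_(k+1)) =
   t. *)
rewrite ltnn mulr1n.
have -> : - (b k.+1 * e k / e k.+1) * - (b k.+1 * e k / e k.+1) +
    e k.+1 * e k.+1 * (1 - b k.+1) =
    b k.+1 * (b k.+1 * e k ^+ 2) / e k.+1 ^+ 2 + e k.+1 ^+ 2 * (1 - b k.+1).
  by field; rewrite gt_eqF.
have -> : b k.+1 * e k ^+ 2 = e k.+1 ^+ 2 * (1 - b k.+1).
  rewrite sk1 sk; apply/eqP; rewrite -subr_eq0.
  by apply/eqP; rewrite -[RHS](subrr t) -{1}rk -rk1; ring.
have -> : b k.+1 * (e k.+1 ^+ 2 * (1 - b k.+1)) / e k.+1 ^+ 2 = b k.+1 * (1 - b k.+1).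
  by field; rewrite gt_eqF.
by rewrite sk1 -rk1; ring.
Qed.

Lemma critical_matrix : exists (v : 'cV[R]_n) (A : 'M[R]_n),
  [/\ v^T *m v = 1%:M, A^T *m A = t%:M
    & forall i j : 'I_n, (i <= j)%N -> (v *m v^T - A) j i = 0].
Proof.
exists (\col_i e i), (\matrix_(j, i) a j i); split.
- apply/matrixP => i j; rewrite !ord1 !mxE.
  have := sum_sqr_e (leq0n n); rewrite b0 subr0 big_mkord mulr1n => <-.
  by apply: eq_bigr => k _; rewrite !mxE expr2.
- apply/matrixP => i k; rewrite !mxE.
  wlog ik : i k / (i <= k)%N => [hw|].
    have [/hw //|/ltnW /hw] := leqP i k; rewrite eq_sym => <-.
    by apply: eq_bigr => j _; rewrite !mxE mulrC.
  rewrite -(a_orthogonal ik (ltn_ord k)) big_mkord.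
  by apply: eq_bigr => j _; rewrite !mxE.
- by move=> i j ij; rewrite !mxE big_ord1 !mxE /a ij subrr.
Qed.

End CriticalMatrix.

(** Cayley-Hamilton: the characteristic polynomial is ['X^n]. The transpose appears because
    [is_trig_mx] means lower triangular. *)
Lemma strictly_upper_exprn (F : comNzRingType) (n : nat) (N : 'M[F]_n) :
  (forall i j : 'I_n, (i <= j)%N -> N j i = 0) -> N ^+ n = 0.
Proof.
case: n N => [|n] N hN; first by apply/matrixP => -[].
have trigN : is_trig_mx N^T.
  by apply/is_trig_mxP => i j ij; rewrite mxE hN // ltnW.
have char_tr : char_poly N = char_poly N^T.
  rewrite /char_poly -det_tr; congr (\det _).
  by apply/matrixP => i j; rewrite !mxE eq_sym.
have := Cayley_Hamilton N; rewrite char_tr char_poly_trig //.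
rewrite (eq_bigr (fun=> 'X)) => [|i _]; last by rewrite mxE hN // subr0.
by rewrite prodr_const card_ord rmorphXn /= horner_mx_X.
Qed.

(** * Upper bound for [nu Q], by unitary equivalence *)

Section UpperBound.
Variable R : realType.

Lemma rdotxx_complex (n : nat) (x : 'cV[R[i]]_n) :
  x ^t* *m x = (rdot x x)%:C%:M.
Proof.
rewrite [LHS]mx11_scalar; congr (_%:M).
rewrite /rdot; set z := (_ *m _) 0 0; rewrite [z]complexE.
suff -> : complex.Im z = 0 by rewrite mulr0 addr0.
rewrite /z mxE raddf_sum big1 // => i _; rewrite !mxE.
by case: (x i 0) => a b /=; ring.
Qed.

(** A rank factorization Q = c r gives Q = Q^* Q = |c|^2 r^* r, so v = |c| r^* is taken; Q = Q Q =
    |v|^2 Q with Q nonzero then makes v a unit vector. *)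
Lemma rank1_projection (n : nat) (Q : 'M[R[i]]_n) :
  is_projection Q -> \rank Q = 1%N ->
  exists2 v : 'cV[R[i]]_n, v ^t* *m v = 1%:M & Q = v *m v ^t*.
Proof.
move=> hQ rQ.
have [c [r Qcr]] : exists (c : 'cV[R[i]]_n) (r : 'rV[R[i]]_n), Q = c *m r.
  move: (col_base Q) (row_base Q) (mulmx_base Q); rewrite rQ => c r <-.
  by exists c, r.
pose s := (Num.sqrt (rdot c c))%:C : R[i].
have Qv : Q = (s *: r ^t*) *m (s *: r ^t*) ^t*.
  rewrite -{1}hQ.2 -{1}(is_projection_trC hQ) Qcr trmx_mul map_mxM.
  rewrite mulmxA -[_ *m c]mulmxA rdotxx_complex mul_mx_scalar.
  rewrite linearZ map_mxZ trmxCK -scalemxAl -scalemxAr scalerA -scalemxAl.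
  congr (_ *: _).
  rewrite -{1}(sqr_sqrtr (rdot_ge0 c)) rmorphXn /= expr2; congr (_ * _).
  exact/esym/conjc_real.
exists (s *: r ^t*) => //; set v := _ *: _ in Qv *.
rewrite rdotxx_complex; congr (_%:M).
have := hQ.2; rewrite {1 2}Qv mulmxA -[_ *m v]mulmxA rdotxx_complex.
rewrite mul_mx_scalar -scalemxAl -Qv => /eqP.
rewrite -subr_eq0 -{2}[Q]scale1r -scalerBl scaler_eq0 subr_eq0 => /orP[/eqP //|].
by move/eqP=> Q0; move: rQ; rewrite Q0 mxrank0.
Qed.

(** Gram-Schmidt on a matrix with first row v^* yields W. That row is c times the first row of W; c
    = 1 because Gram-Schmidt makes c >= 0 and both rows are unit vectors. *)
Lemma unit_vector_unitarymx (n : nat) (v : 'cV[R[i]]_n.+1) :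
  v ^t* *m v = 1%:M ->
  exists2 W : 'M[R[i]]_n.+1, W \is unitarymx & W *m v = delta_mx 0 0.
Proof.
move=> v1; pose A := \matrix_(i < n.+1) (if i == 0 then v ^t* else 0).
have A0 : row 0 A = v ^t* by rewrite rowK.
have Wu : schmidt A \is unitarymx by apply: schmidt_unitarymx.
exists (schmidt A) => //; set W := schmidt A in Wu *.
have WW : W *m W ^t* = 1%:M by apply/unitarymxP.
have Wrow : row 0 W *m (row 0 W) ^t* = 1%:M.
  rewrite [LHS]mx11_scalar; congr (_%:M).
  transitivity ((W *m W ^t*) 0 0); last by rewrite WW mxE.
  by rewrite !mxE; apply: eq_bigr => j _; rewrite !mxE.
have [c vc] : exists c, v ^t* = c *: row 0 W.
  have := row_schmidt_sub A 0; rewrite A0 (big_pred1 0) => [|k].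
    by rewrite genmxE => /sub_rVP.
  by rewrite leqn0.
have c_ge0 : 0 <= c.
  have := form1_row_schmidt A 0; rewrite A0 dotmxE vc -scalemxAl Wrow.
  by rewrite !mxE mulr1.
have c1 : c = 1.
  have : v ^t* *m (v ^t*) ^t* = 1%:M by rewrite trmxCK.
  rewrite vc linearZ map_mxZ -scalemxAl -scalemxAr Wrow scalerA.
  move/matrixP/(_ 0 0); rewrite !mxE mulr1.
  rewrite [X in c * X](CrealP (ger0_real c_ge0)) => cc.
  by apply/eqP; rewrite -(@pexpr_eq1 _ c 2) // expr2 cc.
have -> : v = (row 0 W) ^t* by rewrite -[row 0 W]scale1r -c1 -vc trmxCK.
by rewrite tr_row map_col colE mulmxA WW mul1mx.
Qed.

Lemma unitarymx_transitive (n : nat) (v w : 'cV[R[i]]_n.+1) :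
  v ^t* *m v = 1%:M -> w ^t* *m w = 1%:M ->
  exists2 U : 'M[R[i]]_n.+1, U \is unitarymx & U *m v = w.
Proof.
move=> /unit_vector_unitarymx [X Xu Xv] /unit_vector_unitarymx [Y Yu Yw].
have /unitarymxP/mulmx1C YY := Yu.
exists (Y ^t* *m X); last by rewrite -mulmxA Xv -Yw mulmxA YY mul1mx.
by apply: mul_unitarymx Xu; rewrite trmxC_unitary.
Qed.

(** Conjugating by a unitary that sends the unit vector of Q to the critical one turns Q - N into
    U^* B U, which is sqrt t times an isometry. *)
Lemma nu_rank1_le (n : nat) (Q : 'M[R[i]]_n) (t : R) (v : 'cV[R]_n) (A : 'M[R]_n) :
  is_projection Q -> \rank Q = 1%N -> 0 <= t ->
  v^T *m v = 1%:M -> A^T *m A = t%:M ->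
  (forall i j : 'I_n, (i <= j)%N -> (v *m v^T - A) j i = 0) ->
  nu Q <= Num.sqrt t.
Proof.
case: n Q v A => [|n] Q v A hQ rQ t0 vv AA upper.
  by move: rQ; rewrite [Q]flatmx0 mxrank0.
have [q qq Qq] := rank1_projection hQ rQ.
pose toC := real_complex R.
have conj_real m p (B : 'M[R]_(m, p)) : (map_mx toC B) ^t* = map_mx toC B^T.
  by apply/matrixP => i j; rewrite !mxE; exact: conjc_real.
pose e := map_mx toC v; pose B := map_mx toC A.
have ee : e ^t* *m e = 1%:M by rewrite conj_real -map_mxM vv map_mx1.
have BB : B ^t* *m B = t%:C%:M by rewrite conj_real -map_mxM AA map_scalar_mx.
have [U /unitarymxP UU Uq] := unitarymx_transitive qq ee.
have UU' := mulmx1C UU.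
pose T := e *m e ^t* - B.
have Tn : T ^+ n.+1 = 0.
  apply: strictly_upper_exprn => i j ij.
  by rewrite /T conj_real -map_mxM -map_mxB mxE upper.
pose N := U ^t* *m T *m U.
have hN : nilpotentmx N.
  (* [U ^t*] intertwines N with T, so nilpotency of T passes to N. *)
  have NU1 : N *m U ^t* = U ^t* *m T by rewrite /N -[LHS]mulmxA UU mulmx1.
  exists n.+1; have NU k : N ^+ k *m U ^t* = U ^t* *m T ^+ k.
    elim: k => [|k IH]; first by rewrite !expr0 mul1mx mulmx1.
    by rewrite exprSr [T ^+ _]exprSr -!mulmxE -mulmxA NU1 mulmxA IH mulmxA.
  by rewrite -[LHS]mulmx1 -UU' mulmxA NU Tn mulmx0 mul0mx.
have QN : Q - N = U ^t* *m B *m U.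
  have -> : Q = U ^t* *m (e *m e ^t*) *m U.
    have qU : q = U ^t* *m e by rewrite -Uq mulmxA UU' mul1mx.
    by rewrite Qq qU trmx_mul map_mxM trmxCK !mulmxA.
  by rewrite /N -mulmxBl -mulmxBr /T opprB addrC subrK.
apply: nu_le hN _ => x x1; rewrite QN.
rewrite -[leRHS]mulr1; apply: (@le_trans _ _ (Num.sqrt t * enorm x)); last first.
  by rewrite ler_wpM2l ?sqrtr_ge0.
rewrite !enormE -sqrtrM // rdot_mull !trmx_mul !map_mxM trmxCK !mulmxA.
rewrite -[_ *m U *m U ^t*]mulmxA UU mulmx1 -[_ *m B ^t* *m B]mulmxA BB.
by rewrite mul_mx_scalar -scalemxAl -scalemxAl UU' mul1mx rdotZr.
Qed.

End UpperBound.

Theorem theorem4 (R : realType) (n : nat) (hn : (0 < n)%N)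
    (Q : 'M[R[i]]_n) (hQ : is_projection Q) (rQ : \rank Q = 1%N)
    (M : 'M[R[i]]_n)
    (hM : exists P : 'M[R[i]]_n,
        [/\ is_projection P, P <> 0, P *m M *m P = M
          & loewner_le P (M ^t* *m M)]) :
  nu Q <= nu M.
Proof.
have [t [b [t_gt0 b0 bn b_lt1 b_rec]]] := critical_sequence R hn.
have [P [hP P0 PMP le_PM]] := hM.
have [v [A [vv AA upper]]] := critical_matrix t_gt0 b0 bn b_lt1 b_rec.
apply: le_trans (nu_rank1_le hQ rQ (ltW t_gt0) vv AA upper) _.
exact: nu_lower_bound hn t_gt0 b0 bn b_lt1 b_rec hP P0 PMP le_PM.
Qed.
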